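(* Let $n,k$ be integers with $1\le k\le n$. Suppose $\mathcal{P}\subseteq\mathcal{A}(n,k)$ has packing dimension $t>0$, and let $s>0$. For each $P\in\mathcal{P}$ let $P'\subseteq P$ be a subset of packing dimension at least $s$, and let $F=\bigcup_{P\in\mathcal{P}}P'$. Then $$\dim_P(F)\ \ge\ \max\left\{s,\ \frac{t-(k-\lceil s\rceil)(n-k)}{\lceil s\rceil+1}\right\}.$$
   Context: $\mathcal{A}(n,k)$ denotes the affine Grassmannian, i.e. the set of all affine $k$-planes in $\mathbb{R}^n$. Each $P\in\mathcal{A}(n,k)$ is uniquely written $P=V+t$ with $V$ a $k$-dimensional linear subspace of $\mathbb{R}^n$ and $t\in V^\perp$. The metric on $\mathcal{A}(n,k)$ (with respect to which packing dimension of sets of planes is taken) is $\rho(V_1+t_1,V_2+t_2)=\sup_{|x|=1}|\pi_{V_1}x-\pi_{V_2}x|+|t_1-t_2|$, where $\pi_V$ is the orthogonal projection onto $V$. $\dim_P$ denotes packing dimension. *)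

(* Defs.v *)
From HB Require Import structures.
From mathcomp Require Import all_boot all_order all_algebra.
From mathcomp Require Import all_classical all_reals all_analysis.

Set Implicit Arguments.
Unset Strict Implicit.
Unset Printing Implicit Defensive.

Import Order.TTheory GRing.Theory Num.Theory.

Local Open Scope classical_set_scope.
Local Open Scope ring_scope.

Section packing_dimension.
Context {R : realType} {T : Type}.
(* The distance is an explicit argument because the metric that MathComp-Analysis
   puts on ['rV[R]_n] is the sup metric, not the Euclidean one. *)
Variable dist : T -> T -> R.

Implicit Types (E : set T) (s delta : R).

Definition dball (x : T) (r : R) : set T := [set y | dist x y <= r].

(* A finite or countable family [(c i, r i)], [i \in D], of centers and radii. *)
Definition is_packing E delta (D : set nat) (c : nat -> T) (r : nat -> R) :=
  (forall i, D i -> E (c i) /\ 0 < r i <= delta) /\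
  trivIset D (fun i => dball (c i) (r i)).

(* A ball of radius [r] is given the size [2 r], which is its diameter in
   Euclidean space but possibly more than that in a general metric space. *)
Definition packing_premeasure_at s delta E : \bar R :=
  ereal_sup [set x | exists D c r, is_packing E delta D c r /\
                       x = \esum_(i in D) ((2 * r i) `^ s)%:E].

(* The limit as [delta] tends to [0] is an infimum, by monotonicity. *)
Definition packing_premeasure s E : \bar R :=
  ereal_inf [set packing_premeasure_at s delta E | delta in [set e | 0 < e]].

Definition packing_measure s E : \bar R :=
  ereal_inf [set (\sum_(0 <= i <oo) packing_premeasure s (A i))%E |
              A in [set A : (set T)^nat | E `<=` \bigcup_i A i]].

Definition packing_dim E : \bar R :=
  ereal_inf [set s%:E | s in [set s | 0 <= s /\ packing_measure s E = 0%E]].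

End packing_dimension.

Section euclidean.
Context {R : realType} {n : nat}.
Implicit Types (x y : 'rV[R]_n) (V : 'M[R]_n).

Definition eucl_norm x : R := Num.sqrt (\sum_(i < n) x 0 i ^+ 2).

Definition eucl_dist x y : R := eucl_norm (x - y).

(* A linear subspace of R^n is the row space of an [n x n] matrix. *)
Definition ocompl V : 'M[R]_n := orthomx idfun 1%:M V.

Definition oproj V x : 'rV[R]_n := x *m proj_mx V (ocompl V).

Lemma ocomplP x V :
  reflect (forall v : 'rV_n, (v <= V)%MS -> \sum_(i < n) x 0 i * v 0 i = 0)
          (x <= ocompl V)%MS.
Proof.
have dotE (u v : 'rV[R]_n) : (u *m v^T) 0 0 = \sum_(i < n) u 0 i * v 0 i.
  by rewrite mxE; apply: eq_bigr => i _; rewrite mxE.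
rewrite /ocompl /orthomx mul1mx map_mx_id //.
apply: (iffP sub_kermxP) => [xV v /submxP[a ->]|xV].
  by rewrite -dotE trmx_mul mulmxA xV mul0mx mxE.
apply/rowP => j; rewrite !mxE -[RHS](xV (row j V) (row_sub j V)).
by apply: eq_bigr => i _; rewrite !mxE.
Qed.

Lemma capmx_ocompl V : (V :&: ocompl V = 0)%MS.
Proof.
apply/eqP/rowV0P => v; rewrite sub_capmx => /andP[vV /ocomplP/(_ _ vV) v0].
apply/rowP => i; rewrite mxE; apply/eqP; rewrite -sqrf_eq0 expr2.
move/eqP: v0; rewrite psumr_eq0 => [/allP/(_ i)|j _]; last exact: sqr_ge0.
by rewrite mem_index_enum => /(_ isT).
Qed.

Lemma addsmx_ocompl V : (1%:M <= V + ocompl V)%MS.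
Proof.
rewrite sub1mx /row_full mxrank_disjoint_sum ?capmx_ocompl //.
rewrite /ocompl /orthomx mul1mx map_mx_id // mxrank_ker mxrank_tr.
by rewrite subnKC // rank_leq_col.
Qed.

Lemma oproj_sub V x : (oproj V x <= V)%MS.
Proof. exact: proj_mx_sub. Qed.

Lemma oproj_compl V x : (x - oproj V x <= ocompl V)%MS.
Proof.
apply: proj_mx_compl_sub; apply: submx_trans (addsmx_ocompl V).
by rewrite submx1.
Qed.

End euclidean.

(* The plane [direction + offset]. Requiring the matrix to be the canonical
   generator [<<_>>] of its row space makes [direction] unique, so that equality
   in this type is equality of planes (see [plane_set_inj]). *)
Record affine_plane (R : realType) (n k : nat) := AffinePlane {
  direction : 'M[R]_n;
  offset : 'rV[R]_n;
  direction_gen : <<direction>>%MS = direction;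
  rank_direction : \rank direction = k;
  offset_ortho : (offset <= ocompl direction)%MS }.

Section affine_plane.
Context {R : realType} {n k : nat}.
Implicit Types P Q : affine_plane R n k.

Definition plane_set P : set 'rV[R]_n :=
  [set x | (x - offset P <= direction P)%MS].

Definition plane_dist P Q : R :=
  sup [set eucl_norm (oproj (direction P) x - oproj (direction Q) x)
        | x in [set x | eucl_norm x = 1]] +
  eucl_norm (offset P - offset Q).

Lemma plane_set_inj : injective plane_set.
Proof.
move=> P Q PQ.
have off (P1 P2 : affine_plane R n k) : plane_set P1 = plane_set P2 ->
    (offset P1 - offset P2 <= direction P2)%MS.
  move=> e; have : plane_set P1 (offset P1) by rewrite /plane_set /= subrr sub0mx.
  by rewrite e.
have dir (P1 P2 : affine_plane R n k) : plane_set P1 = plane_set P2 ->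
    (direction P1 <= direction P2)%MS.
  move=> e; apply/row_subP => i.
  have : plane_set P1 (row i (direction P1) + offset P1).
    by rewrite /plane_set /= addrK row_sub.
  rewrite e /plane_set /= -addrA => h.
  by rewrite -[row i _](addrK (offset P1 - offset P2)) addmx_sub ?eqmx_opp ?off.
have dPQ : direction P = direction Q.
  rewrite -(direction_gen P) -(direction_gen Q); apply/eq_genmx/eqmxP.
  by rewrite !dir.
have oPQ : offset P = offset Q.
  apply/eqP; rewrite -subr_eq0 -submx0 -(capmx_ocompl (direction Q)).
  rewrite sub_capmx off // addmx_sub ?eqmx_opp ?offset_ortho // -dPQ.
  exact: offset_ortho.
case: P Q dPQ oPQ {PQ off dir} => [V t a b c] [V' t' a' b' c'] /= eV et.
by subst V' t'; congr AffinePlane; exact: Prop_irrelevance.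
Qed.

Lemma plane_set_surj (V : 'M[R]_n) (a : 'rV[R]_n) : \rank V = k ->
  exists P, plane_set P = [set x | (x - a <= V)%MS].
Proof.
move=> rV; pose t := a - oproj V a.
have gV : (<<V>> :=: V)%MS by exact: genmxE.
have oV : (t <= ocompl <<V>>)%MS.
  apply/ocomplP => v; rewrite gV; apply/ocomplP; exact: oproj_compl.
have rV' : \rank <<V>> = k by rewrite gV.
exists (AffinePlane (genmx_id V) rV' oV); apply/seteqP.
have tE x : x - t = (x - a) + oproj V a by rewrite /t opprB addrCA addrC.
split=> x; rewrite /plane_set /= gV tE => h; last by rewrite addmx_sub ?oproj_sub.
by rewrite -[x - a](addrK (oproj V a)) addmx_sub ?eqmx_opp ?oproj_sub.
Qed.

End affine_plane.

(* Main.v *)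
Require Import Defs.
From mathcomp Require Import all_boot all_order all_algebra.
From mathcomp Require Import all_classical all_reals all_analysis.
From mathcomp Require finmap.
From mathcomp Require Import zify ring lra.

Set Implicit Arguments.
Unset Strict Implicit.
Unset Printing Implicit Defensive.

Import Order.TTheory GRing.Theory Num.Theory.

Local Open Scope classical_set_scope.
Local Open Scope ring_scope.

(* Put m = ceil s. A subset of a d-dimensional affine plane has packing dimension at
   most d, so P' P, of dimension at least s > m - 1, contains m + 1 affinely
   independent points. These points together with (k - m) (n - k) bounded real
   parameters determine P in a Lipschitz way, once finitely many discrete choices
   and a bound on the conditioning are fixed. Hence dim calP is at most
   (m + 1) dim F + (k - m) (n - k). The dimensions are compared through the upper
   box dimensions of the pieces of countable covers: finite packing measure bounds
   the number of separated points at small scales, and conversely such a bound makes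
   the packing sums of a larger exponent geometric. *)

(** * Packing dimension and upper box dimension *)

Lemma ge1_powRN {R : realType} (r v : R) : 0 < r <= 1 -> 0 <= v -> 1 <= r `^ (- v).
Proof. by move=> r01 v0; rewrite -[leLHS](powRr0 r) ger_powR// oppr_le0. Qed.

Lemma esum_le_finite {R : realType} (D : set nat) (a : nat -> R) (M : R) :
  (forall X : seq nat, uniq X -> (forall i, i \in X -> D i) ->
     \sum_(i <- X) a i <= M) ->
  (\esum_(i in D) (a i)%:E <= M%:E)%E.
Proof.
move=> aM; apply: ge_ereal_sup => _ [X [finX XD] <-].
rewrite fsbig_finite// sumEFin lee_fin; apply: aM; first exact: finmap.fset_uniq.
by move=> i; rewrite in_fset_set// => /set_mem /XD.
Qed.

Section box_dimension.
Context {R : realType} {T : Type}.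
Variable dist : T -> T -> R.
Implicit Types (A E : set T) (r s u v w : R).

(* A finite colouring whose colour classes have diameter at most [r] stands for a
   cover; in this form images and products are handled by composing and pairing
   colourings. *)
Definition upper_box_le A v := exists C r0, 0 < r0 /\
  forall r, 0 < r <= r0 -> exists K : finType, #|K|%:R <= C * r `^ (- v) /\
    exists f : T -> K, forall x y, A x -> A y -> f x = f y -> dist x y <= r.

(** The infimum of such [v] is the modified upper box dimension of [E]; [packing_dim_le] and
    [packing_dim_lt] compare it with the packing dimension from the two sides. *)
Definition sigma_box_le E v := exists A : (set T)^nat,
  E `<=` \bigcup_i A i /\ forall i, upper_box_le (A i) v.

Lemma sub_sigma_box_le E E' v :
  E `<=` E' -> sigma_box_le E' v -> sigma_box_le E v.
Proof. by move=> EE' [A [E'A Av]]; exists A; split=> //; apply: subset_trans E'A. Qed.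

Lemma upper_box_le_set0 v : 0 <= v -> upper_box_le set0 v.
Proof.
move=> v0; exists 1, 1; split=> // r r01; exists unit; split; last by exists (fun=> tt).
by rewrite card_unit mul1r ge1_powRN.
Qed.

Lemma countable_sigma_box_le (I : countType) (A : I -> set T) E v : 0 <= v ->
  E `<=` \bigcup_i A i -> (forall i, upper_box_le (A i) v) -> sigma_box_le E v.
Proof.
move=> v0 EA Av; exists (fun j => if unpickle j is Some i then A i else set0); split.
  by move=> x /EA[i _ Aix]; exists (pickle i); rewrite //= pickleK.
by move=> j; case: (unpickle j) => [i//|]; exact: upper_box_le_set0.
Qed.

Lemma size_separated_le (K : finType) (f : T -> K) A r (X : seq nat) (c : nat -> T) :
  (forall x y, A x -> A y -> f x = f y -> dist x y <= r) ->
  uniq X -> (forall i, i \in X -> A (c i)) ->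
  (forall i j, i \in X -> j \in X -> i != j -> r < dist (c i) (c j)) ->
  (size X <= #|K|)%N.
Proof.
move=> fA uX XA Xr; rewrite -(size_map (f \o c)) -(card_uniqP _) ?max_card//.
rewrite map_inj_in_uniq// => i j iX jX /= fij.
by apply: contrapT => /eqP /(Xr _ _ iX jX); rewrite ltNge fA//; exact: XA.
Qed.

(** One ball misses the centre of the other. In a general metric space disjoint balls give no more:
    their centres need not be further apart than [r i + r j]. *)
Lemma packing_center_dist E delta D c (r : nat -> R) : (forall x, dist x x = 0) ->
  is_packing dist E delta D c r ->
  forall i j, D i -> D j -> i != j -> r i < dist (c i) (c j).
Proof.
move=> d0 [Er /trivIsetP tr] i j Di Dj ij; rewrite ltNge; apply/negP => dij.
have := tr i j Di Dj ij; rewrite -subset0 => /(_ (c j)); apply; split=> //.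
by rewrite /dball/= d0; have [_ /andP[/ltW]] := Er _ Dj.
Qed.

Lemma dyadic_level (x delta : R) : 0 < x <= delta ->
  exists j, delta * 2^-1 ^+ j.+1 < x <= delta * 2^-1 ^+ j.
Proof.
move=> /andP[x0 xd].
have d0 : 0 < delta by exact: lt_le_trans xd.
have : exists j, delta * 2^-1 ^+ j.+1 < x.
  have h1 : `|2^-1 : R| < 1 by rewrite ger0_norm; lra.
  have /cvgrPdist_lt /(_ (x / delta)) := cvg_expr h1.
  rewrite divr_gt0// => /(_ isT)[N _ /(_ N.+1)] /= h; exists N.
  have {h} := h (leqnSn N); rewrite sub0r normrN ger0_norm ?exprn_ge0 ?invr_ge0//.
  by rewrite ltr_pdivlMr// mulrC.
move=> ex; case: (ex_minnP ex) => j hj jmin; exists j; rewrite hj /=.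
case: j hj jmin => [|j] hj jmin; first by rewrite expr0 mulr1.
by rewrite leNgt; apply/negP => /jmin; rewrite ltnn.
Qed.

Lemma geometric_sum_le (q : R) J : 0 <= q < 1 -> \sum_(j < J) q ^+ j <= (1 - q)^-1.
Proof.
move=> /andP[q0 q1]; rewrite -[leRHS]mul1r ler_pdivlMr ?subr_gt0// mulrC.
have := subrX1 q J; rewrite -opprB -[q - 1]opprB mulNr => /oppr_inj <-.
by rewrite lerBlDr lerDl exprn_ge0.
Qed.

(** Sort the balls of a packing by dyadic size. Level [j] holds at most [C * rho j ^ (- v)] of them,
    since their centres get different colours, and each contributes at most [(4 * rho j) ^ w]. The
    levels then sum like a geometric series of ratio [q]. *)
Lemma packing_sum_le A v w : (forall x, dist x x = 0) -> v < w -> 0 < w ->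
  upper_box_le A v -> exists M d0, 0 < d0 /\
  forall delta, 0 < delta <= d0 ->
    (packing_premeasure_at dist w delta A <= (M * delta `^ (w - v))%:E)%E.
Proof.
move=> d0 vw w0 [C [r0 [r0_gt0 Av]]].
pose q : R := 2^-1 `^ (w - v).
have q01 : 0 <= q < 1.
  have wv : 0 < w - v by rewrite subr_gt0.
  rewrite powR_ge0 /=; have <- : 1 `^ (w - v) = 1 :> R by rewrite powR1.
  by apply: (gt0_ltr_powR wv); rewrite ?nnegrE; lra.
exists (C * 4 `^ w * 2^-1 `^ (w - v) * (1 - q)^-1), r0; split=> // delta /andP[dl0 dlr0].
apply: ge_ereal_sup => _ [D [c [r [pk ->]]]].
have sep := packing_center_dist d0 pk.
case: pk => Er _.
apply: esum_le_finite => X uX XD.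
have /choice[lev levP] : forall i, exists j, i \in X ->
    delta * 2^-1 ^+ j.+1 < r i <= delta * 2^-1 ^+ j.
  move=> i; have [iX|] := boolP (i \in X); last by exists 0%N.
  by have [_ /dyadic_level[j]] := Er i (XD _ iX); exists j.
pose J := (\max_(i <- X) lev i).+1.
have levJ i : i \in X -> (lev i < J)%N.
  by move=> iX; rewrite ltnS; apply: leq_bigmax_seq.
(* The radii of level [j] lie above [rho j] and are at most [2 * rho j]: centres are more than
   [rho j] apart, and [2 * r i <= 4 * rho j]. *)
pose rho j : R := delta * 2^-1 ^+ j.+1.
have rho0 j : 0 < rho j by rewrite mulr_gt0 ?exprn_gt0 ?invr_gt0.
have rhor0 j : rho j <= r0.
  apply: le_trans dlr0; rewrite ler_piMr ?(ltW dl0)//.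
  by rewrite exprn_ile1//; lra.
apply: (@le_trans _ _ (\sum_(i <- X) (4 * rho (lev i)) `^ w)).
  rewrite !big_seq; apply: ler_sum => i iX.
  have /andP[ri0 _] : 0 < r i <= delta by have [] := Er i (XD _ iX).
  apply: ge0_ler_powR; rewrite ?(ltW w0)// ?nnegrE ?(mulr_ge0 _ (ltW (rho0 _))) ?(mulr_ge0 _ (ltW ri0))//.
  by have /andP[_] := levP i iX; rewrite /rho exprS; lra.
rewrite (eq_big_seq (fun i => \sum_(j < J | inord (lev i) == j) (4 * rho j) `^ w)); last first.
  move=> i iX; rewrite (big_pred1 (inord (lev i))); last by move=> j; rewrite eq_sym.
  by rewrite inordK// levJ.
rewrite (exchange_big_dep xpredT)//=.
apply: (@le_trans _ _ (\sum_(j < J) C * rho j `^ (- v) * (4 * rho j) `^ w)).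
  apply: ler_sum => j _; rewrite -big_filter big_const_seq count_predT iter_addr_0.
  rewrite -[leLHS]mulr_natl ler_wpM2r ?powR_ge0//.
  have [|K [KC [f fA]]] := Av (rho j); first by rewrite rho0 rhor0.
  apply: le_trans KC; rewrite ler_nat; apply: (size_separated_le (c := c) fA).
  - exact: filter_uniq.
  - by move=> i; rewrite mem_filter => /andP[_ /XD /Er[]].
  - move=> i i'; rewrite !mem_filter => /andP[/eqP ij iX] /andP[_ i'X] ii'.
    apply: lt_trans (sep _ _ (XD _ iX) (XD _ i'X) ii').
    have /andP[+ _] := levP _ iX.
    by rewrite /rho -ij inordK// levJ.
have -> : C * 4 `^ w * 2^-1 `^ (w - v) * (1 - q)^-1 * delta `^ (w - v) =
  C * 4 `^ w * 2^-1 `^ (w - v) * delta `^ (w - v) * (1 - q)^-1 by rewrite mulrAC.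
have C0 : 0 <= C.
  have [|K [KC _]] := Av r0; first by rewrite r0_gt0 lexx.
  by rewrite -(pmulr_lge0 _ (powR_gt0 (- v) r0_gt0)); exact: le_trans KC.
apply: le_trans (ler_wpM2l _ (geometric_sum_le J q01)); last first.
  by rewrite !mulr_ge0 ?powR_ge0.
rewrite big_distrr/=; apply: ler_sum => j _; rewrite le_eqVlt; apply/orP; left; apply/eqP.
rewrite powRM// ?(ltW (rho0 _))//.
have -> : C * rho j `^ (- v) * (4 `^ w * rho j `^ w) =
   C * 4 `^ w * (rho j `^ w * rho j `^ (- v)) by ring.
rewrite -powRD ?(gt_eqF (rho0 _)) ?implybT//.
have h2 : 0 <= 2^-1 :> R by lra.
rewrite /rho exprS !powRM ?(ltW dl0) ?mulr_ge0 ?exprn_ge0//.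
have -> : (2^-1 ^+ j : R) `^ (w - v) = q ^+ j.
  by rewrite -!powR_mulrn ?powR_ge0// /q -!powRrM mulrC.
by ring.
Qed.

(* Without a point in [T] there is no packing, not even the empty one, and the
   supremum defining the premeasure is [-oo]. *)
Variable x0 : T.

Lemma packing_premeasure_at_ge0 w delta A :
  (0 <= packing_premeasure_at dist w delta A)%E.
Proof.
apply: ereal_sup_ubound; exists set0, (fun=> x0), (fun=> 0); rewrite esum_set0.
by split=> //; split=> //; exact/trivIsetP.
Qed.

Lemma packing_premeasure_ge0 w A : (0 <= packing_premeasure dist w A)%E.
Proof.
by apply: le_ereal_inf_tmp => _ [delta _ <-]; exact: packing_premeasure_at_ge0.
Qed.

Lemma packing_measure_ge0 w A : (0 <= packing_measure dist w A)%E.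
Proof.
apply: le_ereal_inf_tmp => _ [B _ <-].
by apply: nneseries_ge0 => *; exact: packing_premeasure_ge0.
Qed.

Lemma packing_premeasure_eq0 A v w : (forall x, dist x x = 0) -> v < w -> 0 < w ->
  upper_box_le A v -> packing_premeasure dist w A = 0%E.
Proof.
move=> d0 vw w0 /(packing_sum_le d0 vw w0)[M [e0 [e0_gt0 AM]]].
apply/eqP; rewrite eq_le packing_premeasure_ge0 andbT.
apply/lee_addgt0Pr => e e_gt0; rewrite add0e.
have wv : 0 < w - v by rewrite subr_gt0.
(* [b] solves [(|M| + 1) * b ^ (w - v) = e]. *)
pose b := (e / (`|M| + 1)) `^ (w - v)^-1.
have M1 : 0 < `|M| + 1 by rewrite ltr_wpDl.
have b0 : 0 < b by rewrite powR_gt0// divr_gt0.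
pose delta := Num.min e0 b.
have delta0 : 0 < delta by rewrite lt_min e0_gt0.
apply: (@le_trans _ _ (packing_premeasure_at dist w delta A)).
  by apply: ereal_inf_lbound; exists delta.
apply: le_trans (AM _ _) _; first by rewrite delta0 ge_min lexx.
rewrite lee_fin; apply: (@le_trans _ _ ((`|M| + 1) * delta `^ (w - v))).
  by rewrite ler_wpM2r ?powR_ge0// ler_wpDr// ler_norm.
rewrite mulrC -ler_pdivlMr//.
apply: (@le_trans _ _ (b `^ (w - v))).
  by rewrite ge0_ler_powR ?nnegrE ?(ltW delta0) ?(ltW b0) ?(ltW wv)// ge_min lexx orbT.
by rewrite -powRrM mulVf ?gt_eqF// powRr1// divr_ge0// ltW.
Qed.

Lemma packing_dim_le E v : (forall x, dist x x = 0) -> 0 <= v ->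
  sigma_box_le E v -> (packing_dim dist E <= v%:E)%E.
Proof.
move=> d0 v0 [A [EA Av]]; apply/lee_addgt0Pr => e e0; rewrite -EFinD.
apply: ereal_inf_lbound; exists (v + e) => //; split; first by rewrite addr_ge0// ltW.
apply/eqP; rewrite eq_le packing_measure_ge0 andbT.
apply: ereal_inf_lbound; exists A => //; apply: eseries0 => i _ _.
by apply: packing_premeasure_eq0 (Av i) => //; [rewrite ltrDl|rewrite ltr_wpDl].
Qed.

Lemma is_packing_const A rho N (c : nat -> T) :
  (forall x y, dist x y = dist y x) ->
  (forall x y z, dist x z <= dist x y + dist y z) ->
  0 < rho -> (forall i, (i < N)%N -> A (c i)) ->
  (forall i j, (i < j < N)%N -> rho *+ 2 < dist (c i) (c j)) ->
  is_packing dist A rho `I_N c (fun=> rho).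
Proof.
move=> dC dT rho0 Ac sep; split; first by move=> i /Ac; rewrite rho0 lexx.
apply/trivIsetP => i j /= iN jN ij; rewrite -subset0 => z [].
rewrite /dball /= => iz jz; suff : dist (c i) (c j) <= rho *+ 2.
  case/boolP: (i < j)%N => [ij'|]; first by rewrite leNgt sep ?ij'.
  by rewrite -leqNgt leq_eqVlt eq_sym (negPf ij) /= => ji; rewrite dC leNgt sep ?ji.
by apply: le_trans (dT _ z _) _; rewrite mulr2n lerD// dC.
Qed.

(** Let [4 * rho = r] and take a largest family of points of [A] more than [2 * rho] apart. The
    balls of radius [rho] around them form a packing, so there are at most [(2 * rho) ^ (- s)] of
    them. By maximality every point of [A] is within [2 * rho] of one of them, which serves as its
    colour. *)
Lemma upper_box_le_of_packing A s delta :
  (forall x y, dist x y = dist y x) ->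
  (forall x y z, dist x z <= dist x y + dist y z) ->
  0 <= s -> 0 < delta -> (packing_premeasure_at dist s delta A < 1)%E ->
  upper_box_le A s.
Proof.
move=> dC dT s0 delta0 A1.
(* There are [N + 1] colours with [N <= (r / 2) ^ (- s)]; for [r <= 1] the extra colour is absorbed
   by doubling. *)
exists (2 * 2^-1 `^ (- s)), (Num.min 1 delta); split; first by rewrite lt_min ltr01.
move=> r /andP[r0]; rewrite le_min => /andP[r1 rd].
pose rho := r / 4; have rho0 : 0 < rho by rewrite divr_gt0.
pose sep N := `[< exists c, (forall i, (i < N)%N -> A (c i)) /\
  (forall i j, (i < j < N)%N -> rho *+ 2 < dist (c i) (c j)) >].
have r2 : 0 < 2 * rho by rewrite mulr_gt0.
have r2E : 2 * rho = r * 2^-1 by rewrite /rho; lra.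
have sepN N : sep N -> N%:R <= (2 * rho) `^ (- s).
  move=> /asboolP[c [Ac sc]].
  have pk : is_packing dist A delta `I_N c (fun=> rho).
    have [Er tr] := is_packing_const dC dT rho0 Ac sc; split=> // i /Er[Ai _].
    by split=> //; rewrite rho0 (le_trans _ rd)// /rho; lra.
  have : (\esum_(i in `I_N) ((2 * rho) `^ s)%:E < 1)%E.
    by apply: le_lt_trans A1; apply: ereal_sup_ubound; exists `I_N, c, (fun=> rho).
  rewrite esum_fset//; last by move=> i _; rewrite lee_fin powR_ge0.
  rewrite -fsbig_ord sumEFin lte_fin sumr_const card_ord -[ltLHS]mulr_natl => /ltW.
  by rewrite powRN -ler_pdivlMr ?powR_gt0// div1r.
have sep0 : exists N, sep N.
  by exists 0%N; apply/asboolP; exists (fun=> x0); split=> // i j; rewrite ltn0 andbF.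
have /(ex_maxnP sep0)[N] : forall N, sep N -> (N <= Num.bound ((2 * rho) `^ (- s)))%N.
  move=> N /sepN Ns; rewrite -(ler_nat R); apply: le_trans Ns _.
  by apply/ltW/archi_boundP; exact: powR_ge0.
move=> /[dup] sN /asboolP[c [Ac sc]] Nmax.
(* [c N] is an arbitrary point, allowed only to keep the set of colours nonempty. *)
have near x : exists i : 'I_N.+1, A x -> dist x (c i) <= 2 * rho.
  apply: contrapT => far.
  have {}far (i : 'I_N.+1) : A x /\ 2 * rho < dist x (c i).
    apply: contrapT => h; apply: far; exists i => Ax; rewrite leNgt; apply/negP => h'.
    by apply: h.
  have Ax : A x by have [] := far ord0.
  suff /Nmax : sep N.+1 by rewrite ltnn.
  apply/asboolP; exists (fun i => if (i < N)%N then c i else x); split=> [i _|i j /andP[ij]].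
    by case: ifPn => // /Ac.
  rewrite ltnS leq_eqVlt => /orP[/eqP jN|jN].
    rewrite -jN ij ltnn dC -mulr_natl.
    have iN : (i < N.+1)%N by rewrite -jN ltnS ltnW.
    by have [_] := far (Ordinal iN).
  by rewrite jN (ltn_trans ij jN) sc// ij.
have [f fP] := choice near.
exists 'I_N.+1; split; last first.
  exists f => x y Ax Ay fxy; apply: le_trans (dT _ (c (f x)) _) _.
  have := lerD (fP x Ax) (fP y Ay); rewrite -fxy [dist y _]dC => /le_trans; apply.
  by rewrite /rho; lra.
rewrite card_ord -[N.+1]add1n natrD.
have -> : 2 * 2^-1 `^ (- s) * r `^ (- s) = (2 * rho) `^ (- s) + (2 * rho) `^ (- s).
  by rewrite r2E powRM ?(ltW r0) ?invr_ge0//; ring.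
apply: lerD (sepN _ sN); rewrite ge1_powRN// r2 r2E; lra.
Qed.

(** Some exponent [s < u] has zero packing measure, so some cover has premeasures summing to less
    than 1. Each piece then stays below 1 at some scale [delta], which bounds its box dimension by
    [s]. *)
Lemma packing_dim_lt E u :
  (forall x y, dist x y = dist y x) ->
  (forall x y z, dist x z <= dist x y + dist y z) ->
  (packing_dim dist E < u%:E)%E -> exists v, [/\ 0 <= v, v < u & sigma_box_le E v].
Proof.
move=> dC dT /ereal_inf_lt[_ [s [s0 Es] <-]]; rewrite lte_fin => su.
exists s; split=> //.
have : (packing_measure dist s E < 1)%E by rewrite Es lte_fin.
move=> /ereal_inf_lt[_ [A EA <-]] A1; exists A; split=> // i.
have : (packing_premeasure dist s (A i) < 1)%E.
  apply: le_lt_trans A1.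
  have h j : (0 <= packing_premeasure dist s (A j))%E by exact: packing_premeasure_ge0.
  apply: le_trans (nneseries_lim_ge i.+1 (fun j _ _ => h j)).
  by rewrite big_nat_recr//= leeDr// sume_ge0.
move=> /ereal_inf_lt[_ [delta /= delta0 <-]]; exact: upper_box_le_of_packing.
Qed.

End box_dimension.

(** * Box dimension of products and intervals *)

Lemma powR_sum {R : realType} (I : Type) (s : seq I) (x : R) (u : I -> R) : 0 < x ->
  x `^ (\sum_(i <- s) u i) = \prod_(i <- s) x `^ (u i).
Proof.
move=> x0; apply: (big_morph (fun a => x `^ a)); last exact: powRr0.
by move=> a b; rewrite powRD// (gt_eqF x0) implybT.
Qed.

(** The last hypothesis says that [x] is an [L]-Lipschitz function of its coordinates [y x] in the
    maximum metric. Tuples of colours at scale [r / L] thus colour [A] at scale [r]; their numbers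
    multiply, so the exponents add. The spaces [S i] may differ, since points and real parameters
    are to be mixed. *)
Lemma upper_box_le_product {R : realType} (T : Type) (dist : T -> T -> R)
  (I : finType) (S : I -> Type) (dS : forall i, S i -> S i -> R)
  (B : forall i, set (S i)) (u : I -> R) (A : set T) (y : T -> forall i, S i) (L : R) :
  0 < L -> (forall i, upper_box_le (dS i) (B i) (u i)) ->
  (forall x, A x -> forall i, B i (y x i)) ->
  (forall x x' e, A x -> A x' -> 0 < e ->
     (forall i, dS i (y x i) (y x' i) <= e) -> dist x x' <= L * e) ->
  upper_box_le dist A (\sum_i u i).
Proof.
move=> L0 /choice[C /choice[r0 CP]] AB AL.
(* The default value 1 keeps [r1] positive when [I] is empty. *)
pose r1 := \big[Num.min/1]_i r0 i.
have r10 : 0 < r1 by apply: lt_bigmin => // i _; have [] := CP i.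
exists (\prod_i C i * L^-1 `^ (- (\sum_i u i))), (L * r1); split; first exact: mulr_gt0.
move=> r /andP[rp rr1]; pose e := r / L.
have e0 : 0 < e by rewrite divr_gt0.
have KP' i : exists K : finType, #|K|%:R <= C i * e `^ (- u i) /\
    exists f : S i -> K, forall x y, B i x -> B i y -> f x = f y -> dS i x y <= e.
  have [_] := CP i; apply; rewrite e0 ler_pdivrMr// mulrC; apply: le_trans rr1 _.
  by rewrite ler_wpM2l ?(ltW L0)// bigmin_le_cond.
pose KP i := cid (KP' i).
pose K i := projT1 (KP i).
have K1 i : #|K i|%:R <= C i * e `^ (- u i) by have [] := projT2 (KP i).
pose K2 i := cid (projT2 (KP i)).2.
pose f i := projT1 (K2 i).
exists {dffun forall i, K i}; split.
  rewrite card_dep_ffun foldrE big_image/= natr_prod.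
  apply: (@le_trans _ _ (\prod_i (C i * e `^ (- u i)))); first by apply: ler_prod => i _; rewrite K1 ler0n.
  rewrite big_split/= -powR_sum// sumrN /e powRM ?(ltW rp) ?invr_ge0 ?(ltW L0)//.
  by rewrite mulrAC mulrA.
exists (fun x => [ffun i => f i (y x i)] : {dffun forall i, K i}) => x x' Ax Ax' fxx'.
have -> : r = L * e by rewrite /e mulrC divfK// gt_eqF.
apply: AL => // i; apply: (projT2 (K2 i)); [exact: AB|exact: AB|].
by have /ffunP/(_ i) := fxx'; rewrite !ffunE.
Qed.

(** The colour of a number is the index of its cell of length [r], counted from [- q]. For [r <= 1]
    the number of cells is at most [2 * q / r + 1 <= 2 * (q + 1) / r]. *)
Lemma upper_box_le_interval {R : realType} (q : nat) :
  upper_box_le (fun x y : R => `|x - y|) [set x | `|x| <= q%:R] 1.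
Proof.
exists (q.+1 * 2)%:R, 1; split=> // r /andP[r0 r1].
pose M := Num.trunc (2 * q%:R / r).
exists 'I_M.+1; split.
  have : M%:R <= 2 * q%:R / r by rewrite truncn_le divr_ge0 ?mulr_ge0 ?(ltW r0).
  rewrite card_ord powR_inv1 ?(ltW r0)// -[M.+1]add1n natrD => Mq.
  have : 1 <= r^-1 by rewrite invf_ge1.
  by rewrite natrM -natr1; lra.
exists (fun x => inord (Num.trunc ((x + q%:R) / r))) => x y /=.
move=> /ler_normlP[x1 x2] /ler_normlP[y1 y2] /(congr1 val).
have hx z : - z <= q%:R -> z <= q%:R -> 0 <= (z + q%:R) / r /\ (Num.trunc ((z + q%:R) / r) < M.+1)%N.
  move=> z1 z2; split; first by rewrite divr_ge0 ?(ltW r0)//; lra.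
  by rewrite ltnS le_truncn// ler_wpM2r ?invr_ge0 ?(ltW r0)//; lra.
have [x3 x4] := hx x x1 x2; have [y3 y4] := hx y y1 y2.
rewrite /= !inordK// => xy.
have := truncn_itv x3; have := truncn_itv y3; rewrite -xy.
rewrite !ler_pdivlMr// !ltr_pdivrMr// -natr1 mulrDl => /andP[a b] /andP[c d].
by rewrite ler_norml; lra.
Qed.

(** * Euclidean projections *)

Section euclidean_norm.
Context {R : realType} {n : nat}.
Implicit Types (x y z : 'rV[R]_n) (V W : 'M[R]_n).

Definition dot x y : R := \sum_i x 0 i * y 0 i.

Lemma dotC x y : dot x y = dot y x.
Proof. by apply: eq_bigr => i _; rewrite mulrC. Qed.

Lemma dotDl x y z : dot (x + y) z = dot x z + dot y z.
Proof. by rewrite -big_split; apply: eq_bigr => i _; rewrite mxE mulrDl. Qed.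

Lemma dotZl a x z : dot (a *: x) z = a * dot x z.
Proof. by rewrite /dot big_distrr; apply: eq_bigr => i _; rewrite mxE -mulrA. Qed.

Lemma dotNl x z : dot (- x) z = - dot x z.
Proof. by rewrite -scaleN1r dotZl mulN1r. Qed.

Lemma dotDr x y z : dot z (x + y) = dot z x + dot z y.
Proof. by rewrite dotC dotDl !(dotC _ z). Qed.

Lemma dotZr a x z : dot z (a *: x) = a * dot z x.
Proof. by rewrite dotC dotZl (dotC x). Qed.

Lemma dotNr x z : dot z (- x) = - dot z x.
Proof. by rewrite dotC dotNl (dotC x). Qed.

Lemma dot_ge0 x : 0 <= dot x x.
Proof. by apply: sumr_ge0 => i _; rewrite -expr2 sqr_ge0. Qed.

Lemma eucl_norm_ge0 x : 0 <= eucl_norm x.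
Proof. exact: sqrtr_ge0. Qed.

Lemma eucl_norm_sqr x : eucl_norm x ^+ 2 = dot x x.
Proof. by rewrite sqr_sqrtr//; apply: sumr_ge0 => i _; exact: sqr_ge0. Qed.

Lemma eucl_norm_dot x : eucl_norm x = Num.sqrt (dot x x).
Proof. by rewrite -eucl_norm_sqr sqrtr_sqr ger0_norm// eucl_norm_ge0. Qed.

Lemma eucl_norm0 : eucl_norm (0 : 'rV[R]_n) = 0.
Proof. by rewrite eucl_norm_dot -[0](scale0r 0) dotZl mul0r sqrtr0. Qed.

Lemma eucl_normN x : eucl_norm (- x) = eucl_norm x.
Proof. by rewrite !eucl_norm_dot dotNl dotNr opprK. Qed.

Lemma eucl_norm_le x y : (eucl_norm x <= eucl_norm y) = (dot x x <= dot y y).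
Proof. by rewrite !eucl_norm_dot ler_sqrt// dot_ge0. Qed.

Lemma coord_le_eucl_norm x i : `|x 0 i| <= eucl_norm x.
Proof.
rewrite eucl_norm_dot -sqrtr_sqr ler_sqrt ?dot_ge0// /dot (bigD1 i)//= expr2 lerDl.
by apply: sumr_ge0 => j _; rewrite -expr2 sqr_ge0.
Qed.

Lemma eucl_norm_le_coord x a : 0 <= a -> (forall i, `|x 0 i| <= a) ->
  eucl_norm x <= n%:R * a.
Proof.
move=> a0 xa; have na0 : 0 <= n%:R * a by rewrite mulr_ge0.
rewrite eucl_norm_dot -[leRHS]ger0_norm// -sqrtr_sqr ler_sqrt ?sqr_ge0//.
apply: (@le_trans _ _ (\sum_(i < n) a ^+ 2)).
  by apply: ler_sum => i _; rewrite -expr2 -real_normK ?num_real// lerXn2r ?nnegrE.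
rewrite sumr_const card_ord -[leLHS]mulr_natl exprMn ler_wpM2r ?sqr_ge0//.
by rewrite -natrX ler_nat; case: (n) => // p; rewrite -[X in (X <= _)%N]expn1 leq_pexp2l.
Qed.

Lemma dot_le_eucl_norm x y : dot x y <= eucl_norm x * eucl_norm y.
Proof.
set a := eucl_norm x; set b := eucl_norm y.
have a0 : 0 <= a by exact: eucl_norm_ge0.
have b0 : 0 <= b by exact: eucl_norm_ge0.
have zero u v : eucl_norm u = 0 -> dot u v = 0.
  move=> u0; apply: big1 => i _; have := coord_le_eucl_norm u i.
  by rewrite u0 normr_le0 => /eqP ->; rewrite mul0r.
have [a1|a1] := eqVneq a 0; first by rewrite zero// a1 mul0r.
have [b1|b1] := eqVneq b 0; first by rewrite dotC zero// b1 mulr0.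
have ab : 0 < a * b by rewrite mulr_gt0 ?lt_neqAle ?a0 ?b0 ?andbT// eq_sym.
have := dot_ge0 (b *: x - a *: y).
rewrite dotDl !dotDr !dotNl !dotNr !dotZl !dotZr -!eucl_norm_sqr -/a -/b (dotC y x) => h.
by rewrite -(ler_pM2l ab); nra.
Qed.

Lemma eucl_normD x y : eucl_norm (x + y) <= eucl_norm x + eucl_norm y.
Proof.
have s0 : 0 <= eucl_norm x + eucl_norm y by rewrite addr_ge0 ?eucl_norm_ge0.
rewrite -(@ler_pXn2r _ 2)// ?nnegrE ?eucl_norm_ge0// eucl_norm_sqr.
rewrite dotDl !dotDr sqrrD !eucl_norm_sqr (dotC y x).
by have := dot_le_eucl_norm x y; lra.
Qed.

Lemma eucl_normB x y : eucl_norm (x - y) <= eucl_norm x + eucl_norm y.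
Proof. by rewrite -(eucl_normN y) eucl_normD. Qed.

Lemma eucl_distC x y : eucl_dist x y = eucl_dist y x.
Proof. by rewrite /eucl_dist -eucl_normN opprB. Qed.

Lemma eucl_dist_triangle x y z : eucl_dist x z <= eucl_dist x y + eucl_dist y z.
Proof. by rewrite /eucl_dist -[x - z](subrKA y) eucl_normD. Qed.

Lemma eucl_distxx x : eucl_dist x x = 0.
Proof. by rewrite /eucl_dist subrr eucl_norm0. Qed.

Lemma oprojB V x y : oproj V (x - y) = oproj V x - oproj V y.
Proof. exact: mulmxBl. Qed.

Lemma dot_oproj_compl V u x : (u <= V)%MS -> dot u (x - oproj V x) = 0.
Proof. by move=> uV; rewrite dotC; exact: (ocomplP _ _ (oproj_compl V x)). Qed.

Lemma oproj_pythagoras V x :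
  dot x x = dot (oproj V x) (oproj V x) + dot (x - oproj V x) (x - oproj V x).
Proof.
have := dot_oproj_compl x (oproj_sub V x).
by rewrite dotDr dotNr dotDl !dotDr !dotNl !dotNr (dotC x (oproj V x)); lra.
Qed.

Lemma oproj_norm_le V x : eucl_norm (oproj V x) <= eucl_norm x.
Proof. by rewrite eucl_norm_le (oproj_pythagoras V x) lerDl dot_ge0. Qed.

Lemma oproj_compl_norm_le V x : eucl_norm (x - oproj V x) <= eucl_norm x.
Proof. by rewrite eucl_norm_le (oproj_pythagoras V x) lerDr dot_ge0. Qed.

Lemma oproj_unique V u w : (u <= V)%MS -> (w <= ocompl V)%MS -> oproj V (u + w) = u.
Proof.
move=> uV wV; apply/eqP; rewrite -subr_eq0 -submx0 -(capmx_ocompl V) sub_capmx.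
rewrite addmx_sub ?eqmx_opp ?oproj_sub//=.
have -> : oproj V (u + w) - u = w - ((u + w) - oproj V (u + w)).
  by rewrite opprB opprD [RHS]addrC addrA subrK.
by rewrite addmx_sub ?eqmx_opp ?oproj_compl.
Qed.

(* [eta] bounds the gap from [V] to [W] and from [W] to [V]. With P, Q the two
   projections, P - Q = (1 - Q) P - Q (1 - P), and Q (1 - P) is the adjoint of
   (1 - P) Q. *)
Lemma oproj_dist_le V W eta x : 0 <= eta ->
  (forall v, (v <= V)%MS -> exists2 w, (w <= W)%MS & eucl_norm (v - w) <= eta * eucl_norm v) ->
  (forall w, (w <= W)%MS -> exists2 v, (v <= V)%MS & eucl_norm (w - v) <= eta * eucl_norm w) ->
  eucl_norm (oproj V x - oproj W x) <= 2 * eta * eucl_norm x.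
Proof.
move=> eta0 VW WV.
(* The projection does at least as well as any [w] in [U']: [u - oproj U' u] is the complementary
   projection of [u - w]. *)
have gap (U U' : 'M[R]_n) :
    (forall v, (v <= U)%MS -> exists2 w, (w <= U')%MS & eucl_norm (v - w) <= eta * eucl_norm v) ->
    forall u, (u <= U)%MS -> eucl_norm (u - oproj U' u) <= eta * eucl_norm u.
  move=> UU' u /UU'[w wU' uw]; apply: le_trans uw.
  have wE : oproj U' w = w by rewrite -[in LHS](addr0 w) oproj_unique// sub0mx.
  apply: le_trans (oproj_compl_norm_le U' _).
  by rewrite oprojB wE opprB addrA subrK.
pose y := oproj W (x - oproj V x).
have yx : eucl_norm y <= eta * eucl_norm x.
  have yW : (y <= W)%MS by exact: oproj_sub.
  (* Self-adjointness gives [dot y y = dot (y - oproj V y) x]; as [y] lies in [W], the gap from [W]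
     to [V] bounds [y - oproj V y]. *)
  have h1 : eucl_norm y ^+ 2 <= eta * eucl_norm y * eucl_norm x.
    rewrite eucl_norm_sqr.
    have -> : dot y y = dot y (x - oproj V x).
      apply/eqP; rewrite eq_sym -subr_eq0 -dotNr -dotDr; apply/eqP; exact: dot_oproj_compl.
    have -> : dot y (x - oproj V x) = dot (y - oproj V y) x.
      have := dot_oproj_compl x (oproj_sub V y); have := dot_oproj_compl y (oproj_sub V x).
      rewrite !dotDr !dotDl !dotNr !dotNl => h2 h3.
      by rewrite (dotC y (oproj V x)); move: h2 h3; rewrite (dotC (oproj V y) (oproj V x)); lra.
    apply: le_trans (dot_le_eucl_norm _ _) _.
    by rewrite ler_wpM2r ?eucl_norm_ge0// (gap W V WV).
  have := eucl_norm_ge0 y; rewrite le_eqVlt => /orP[/eqP <-|y0].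
    by rewrite mulr_ge0 ?eucl_norm_ge0.
  by rewrite -(ler_pM2l y0) -expr2 (le_trans h1)// mulrCA mulrA.
have -> : oproj V x - oproj W x = (oproj V x - oproj W (oproj V x)) - y.
  by rewrite /y oprojB opprB addrA subrK.
apply: le_trans (eucl_normB _ _) _.
have := gap V W VW _ (oproj_sub V x).
have : eta * eucl_norm (oproj V x) <= eta * eucl_norm x by rewrite ler_wpM2l// oproj_norm_le.
by lra.
Qed.

End euclidean_norm.

(** * Bounded coordinates, independent points and adapted bases *)

Lemma mulmx_entry_le {R : realType} (p q r : nat) (A : 'M[R]_(p, q)) (B : 'M[R]_(q, r))
  (a b : R) : 0 <= a -> (forall i j, `|A i j| <= a) -> (forall i j, `|B i j| <= b) ->
  forall i j, `|(A *m B) i j| <= q%:R * (a * b).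
Proof.
move=> a0 Aa Bb i j; rewrite mxE; apply: le_trans (ler_norm_sum _ _ _) _.
apply: (@le_trans _ _ (\sum_(k < q) a * b)).
  by apply: ler_sum => k _; rewrite normrM ler_pM.
by rewrite sumr_const card_ord -[leLHS]mulr_natl.
Qed.

(** The bound is a natural number so that pieces indexed by it form a countable cover. *)
Lemma mx_bounded {R : realType} (p q : nat) (A : 'M[R]_(p, q)) :
  exists b : nat, forall i j, `|A i j| <= b%:R.
Proof.
exists (Num.bound (\sum_i \sum_j `|A i j|)) => i j.
have s0 : 0 <= \sum_i \sum_j `|A i j| by apply: sumr_ge0 => *; apply: sumr_ge0.
apply: le_trans (ltW (archi_boundP s0)).
rewrite (bigD1 i)//= (bigD1 j)//= -addrA lerDl addr_ge0// ?sumr_ge0// => *.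
by rewrite sumr_ge0.
Qed.

(** Where the coordinates [c x] with respect to [B] are bounded by [q], the point [x] is a Lipschitz
    function of [d] numbers from an interval, each of exponent 1. *)
Lemma packing_dim_affine_le {R : realType} (n d : nat) (B : 'M[R]_(d, n)) (a : 'rV[R]_n)
  (E : set 'rV[R]_n) : (forall x, E x -> (x - a <= B)%MS) ->
  (packing_dim eucl_dist E <= d%:R%:E)%E.
Proof.
move=> EB; apply: (packing_dim_le 0 (@eucl_distxx R n)) => //.
pose c x := (x - a) *m pinvmx B.
pose A (q : nat) := E `&` [set x | forall j, `|c x 0 j| <= q%:R].
apply: (@countable_sigma_box_le _ _ _ _ A) => // [x Ex|q].
  by have [q qP] := mx_bounded (c x); exists q => //; split.
have [b Bb] := mx_bounded B.
have -> : d%:R = \sum_(i < d) 1 :> R by rewrite sumr_const card_ord.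
(* The summand 1 keeps [L] positive when the product vanishes. *)
pose L := n%:R * (d%:R * b%:R) + 1 : R.
apply: (@upper_box_le_product _ _ _ _ (fun=> R) _ _ _ _ (fun x j => c x 0 j) L).
- by rewrite /L ltr_wpDl// !mulr_ge0.
- by move=> j; exact: (upper_box_le_interval q).
- by move=> x [_ xq] j; exact: xq.
move=> x x' e [Ex _] [Ex' _] e0 xx'.
have xE : x - x' = (c x - c x') *m B.
  by rewrite mulmxBl !mulmxKpV ?EB// opprB addrA subrK.
rewrite /eucl_dist xE; apply: (@le_trans _ _ (n%:R * (d%:R * (e * b%:R)))).
  apply: eucl_norm_le_coord; first by rewrite !mulr_ge0// ltW.
  move=> i; apply: mulmx_entry_le => //; first exact: ltW.
  by move=> i' j; rewrite (ord1 i') !mxE; have := xx' j; rewrite !mxE.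
have -> : n%:R * (d%:R * (e * b%:R)) = n%:R * (d%:R * b%:R) * e by ring.
by rewrite /L mulrDl mul1r lerDl ltW.
Qed.

(** By induction: if no point of [E] left the affine plane through [x0] spanned by the [d] rows
    already found, the dimension of [E] would be at most [d]. *)
Lemma independent_points {R : realType} (n d : nat) (E : set 'rV[R]_n) (x0 : 'rV[R]_n) :
  (forall d', (d' < d)%N -> (d'%:R%:E < packing_dim eucl_dist E)%E) ->
  exists M : 'M[R]_(d, n), row_free M /\ forall i, E (row i M + x0).
Proof.
elim: d => [|d IH] Ed.
  by exists 0; split; [rewrite /row_free mxrank0|case].
have [|M [freeM ME]] := IH; first by move=> d' d'd; rewrite Ed// ltnW.
have [x [Ex xM]] : exists x, E x /\ ~~ (x - x0 <= M)%MS.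
  apply: contrapT => h; have := Ed d (ltnSn d); rewrite ltNge => /negP; apply.
  apply: (packing_dim_affine_le (B := M) (a := x0)) => x Ex.
  by apply: contrapT => /negP xM; apply: h; exists x.
exists (col_mx (x - x0) M : 'M[R]_(1 + d, n)); split; last first.
  suff ME' (i : 'I_(1 + d)) : E (row i (col_mx (x - x0) M) + x0) by exact: ME'.
  rewrite -[i]splitK; case: (fintype.split _) => j /=.
    by rewrite rowKu row_id subrK.
  by rewrite rowKd.
rewrite /row_free eqn_leq rank_leq_row.
suff : (d < \rank ((x - x0)%R + M)%MS)%N by rewrite addsmxE.
rewrite -[X in (X < _)%N](eqP freeM).
apply: rank_ltmx; rewrite ltmxE addsmxSr /=; apply: contra xM.
exact: submx_trans (addsmxSl _ _).
Qed.

(** The rows of [cokermx A] represent the coordinate vectors modulo the row space of [A]. A maximal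
    independent family of these rows selects the coordinate vectors that complete [A]. *)
Lemma std_basis_completion {F : fieldType} (n p h : nat) (A : 'M[F]_(p, n)) :
  (\rank A + h = n)%N ->
  exists f : {ffun 'I_h -> 'I_n}, row_full (col_mx A (rowsub f 1%:M)).
Proof.
move=> Ah; have e : \rank (cokermx A) = h by rewrite mxrank_coker; lia.
subst h; exists (maxrankfun (cokermx A)).
rewrite -sub1mx -addsmxE; set X := rowsub _ _.
have /submxP[Y YE] : (cokermx A <= X *m cokermx A)%MS.
  by rewrite -rowsubE eq_maxrowsub.
have YX : (1%:M - Y *m X <= A)%MS by rewrite submxE mulmxBl mul1mx -mulmxA -YE subrr.
by rewrite -[1%:M](subrK (Y *m X)) addmx_sub_adds// submxMl.
Qed.

(* [rowsub f 1%:M] spans a coordinate complement of [V], and modulo it [M] is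
   completed by coordinate vectors. A basis vector of [V] congruent to a fixed
   coordinate vector modulo that complement has only [h] free parameters. *)
Lemma adapted_basis {F : fieldType} (m l h : nat) (V : 'M[F]_(m + l + h))
  (M : 'M[F]_(m, m + l + h)) : \rank V = (m + l)%N -> row_free M -> (M <= V)%MS ->
  exists (f : {ffun 'I_h -> 'I_(m + l + h)}) (g : {ffun 'I_l -> 'I_(m + l + h)})
    (D : 'M[F]_(l, h)),
    let N := col_mx M (rowsub g 1%:M + D *m rowsub f 1%:M) in
    (N <= V)%MS /\ row_free N.
Proof.
move=> rV freeM MV.
have [|f fullVK] := @std_basis_completion _ _ _ h V; first by rewrite rV.
exists f; set K := rowsub f 1%:M in fullVK *.
have rVK : \rank (V + K)%MS = (m + l + h)%N by rewrite addsmxE; exact/eqP.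
have rK : (\rank K <= h)%N by exact: rank_leq_row.
have rS := mxrank_sum_cap V K.
have capVK : (V :&: K)%MS = 0.
  by apply/eqP; rewrite -mxrank_eq0; apply/eqP; move: rS rK; rewrite rVK rV; lia.
have rK' : \rank K = h by move: rS; rewrite rVK rV capVK mxrank0; lia.
have rMK : (\rank (col_mx M K) + l = m + l + h)%N.
  rewrite -addsmxE mxrank_disjoint_sum.
    by rewrite (eqP freeM) rK'; lia.
  by apply/eqP; rewrite -submx0 -capVK capmxS.
have [g fullMKG] := std_basis_completion rMK.
exists g; set G := rowsub g 1%:M in fullMKG *.
(* Subtracting from each row of [G] its component in [K] leaves a vector of [V]; the matrix of this
   correction is [D]. *)
have : (G <= V + K)%MS by apply: submx_full; rewrite /row_full rVK.
move=> /sub_addsmxP[[u v] /= GE].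
exists (- v); rewrite /=; set N := col_mx _ _.
have WV : G + - v *m K = u *m V by rewrite GE mulNmx addrK.
split; first by rewrite /N WV col_mx_sub MV submxMl.
rewrite /row_free eqn_leq rank_leq_row /=.
(* [N] and [K] together span the whole space and [K] has rank [h], so [N] has rank at least
   [m + l]. *)
have : (col_mx (col_mx M K) G <= N + K)%MS.
  rewrite !col_mx_sub addsmxSr andbT; apply/andP; split.
    by apply: submx_trans (addsmxSl _ _); rewrite -addsmxE addsmxSl.
  rewrite -[G](addrK (- v *m K)) mulNmx opprK addmx_sub_adds ?submxMl//.
  by rewrite -mulNmx /N -addsmxE addsmxSr.
move=> /mxrankS; rewrite (eqP fullMKG) => /leq_trans/(_ (mxrank_adds_leqif _ _)).
by rewrite rK' leq_add2r.
Qed.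

(** * Planes through given points *)

(** The right inverse [T] reads off the coordinates [v *m T] of [v] in the frame [N]; the same
    coordinates in [N'] give the nearby vector. The bound on [T] is the conditioning of the
    frame. *)
Lemma frame_gap {R : realType} (n k : nat) (U U' : 'M[R]_n) (N N' : 'M[R]_(k, n))
  (T : 'M[R]_(n, k)) (b e : R) : 0 <= b -> 0 <= e ->
  (U <= N)%MS -> (N' <= U')%MS -> N *m T = 1%:M ->
  (forall i j, `|T i j| <= b) -> (forall i j, `|(N - N') i j| <= e) ->
  forall v, (v <= U)%MS -> exists2 w, (w <= U')%MS &
    eucl_norm (v - w) <= n%:R * (k%:R * (n%:R * b)) * e * eucl_norm v.
Proof.
move=> b0 e0 UN NU' NT Tb NNe v vU; exists (v *m T *m N').
  by apply: submx_trans (submxMl _ _) NU'.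
have /submxP[Y vE] : (v <= N)%MS by exact: submx_trans UN.
have -> : v - v *m T *m N' = v *m T *m (N - N').
  by rewrite mulmxBr; congr (_ - _); rewrite vE -(mulmxA Y) NT mulmx1.
have v0 := eucl_norm_ge0 v.
have -> : n%:R * (k%:R * (n%:R * b)) * e * eucl_norm v =
  n%:R * (k%:R * (n%:R * (eucl_norm v * b) * e)) by ring.
apply: eucl_norm_le_coord; first by rewrite !mulr_ge0.
apply: mulmx_entry_le => //; first by rewrite !mulr_ge0.
apply: mulmx_entry_le => // i j; rewrite (ord1 i); exact: coord_le_eucl_norm.
Qed.

Lemma direction_sub_frame {R : realType} (n k : nat) (P : affine_plane R n k)
  (N : 'M[R]_(k, n)) (T : 'M[R]_(n, k)) :
  (N <= direction P)%MS -> N *m T = 1%:M -> (direction P <= N)%MS.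
Proof.
move=> NP NT; have /eqP freeN : row_free N by apply/row_freeP; exists T.
by rewrite -(geq_leqif (mxrank_leqif_sup NP)) rank_direction freeN.
Qed.

Lemma oproj_direction {R : realType} (n k : nat) (P : affine_plane R n k) x :
  plane_set P x -> oproj (direction P) x = x - offset P.
Proof.
by move=> Px; rewrite -{1}(subrK (offset P) x) oproj_unique//; exact: offset_ortho.
Qed.

(** [frame_gap], used in both directions, feeds [oproj_dist_le] for the directions. An offset is a
    point of the plane minus its projection, so the offsets differ by terms in [x - x'] and by the
    difference of the two projections at [x], which is small because [x] is bounded by [b]. *)
Lemma plane_dist_le {R : realType} (n k : nat) (P Q : affine_plane R n k)
  (N N' : 'M[R]_(k, n)) (T T' : 'M[R]_(n, k)) (x x' : 'rV[R]_n) (b e : R) :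
  0 <= b -> 0 <= e -> plane_set P x -> plane_set Q x' ->
  (N <= direction P)%MS -> (N' <= direction Q)%MS ->
  N *m T = 1%:M -> N' *m T' = 1%:M ->
  (forall i j, `|T i j| <= b) -> (forall i j, `|T' i j| <= b) ->
  (forall i j, `|(N - N') i j| <= e) -> eucl_norm x <= b -> eucl_norm (x - x') <= e ->
  plane_dist P Q <= 2 * (n%:R * (k%:R * (n%:R * b)) * (1 + b) + 1) * e.
Proof.
move=> b0 e0 Px Qx' NP NQ NT NT' Tb Tb' NNe xb xx'.
set c := n%:R * (k%:R * (n%:R * b)); have c0 : 0 <= c by rewrite !mulr_ge0.
have ce0 : 0 <= c * e by rewrite mulr_ge0.
have proj z : eucl_norm (oproj (direction P) z - oproj (direction Q) z) <= 2 * (c * e) * eucl_norm z.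
  apply: oproj_dist_le => //.
    exact: (frame_gap b0 e0 (direction_sub_frame NP NT) NQ NT Tb NNe).
  apply: (frame_gap b0 e0 (direction_sub_frame NQ NT') NP NT' Tb') => i j.
  by rewrite -opprB mxE normrN.
have dirle : sup [set eucl_norm (oproj (direction P) z - oproj (direction Q) z)
        | z in [set z | eucl_norm z = 1]] <= 2 * (c * e).
  (* For [n = 0] the unit sphere is empty and the supremum takes its default value 0. *)
  set S := image _ _; have [S0|S0] := pselect (S !=set0).
    by apply: ge_sup => // _ [z /= z1 <-]; apply: le_trans (proj z) _; rewrite z1 mulr1.
  have -> : S = set0 by apply: contrapT => /eqP/set0P.
  by rewrite sup0 mulr_ge0.
have offle : eucl_norm (offset P - offset Q) <= 2 * e + 2 * (c * e) * b.
  have -> : offset P - offset Q = (x - x') -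
      ((oproj (direction P) x - oproj (direction Q) x) + oproj (direction Q) (x - x')).
    rewrite oprojB subrKA !oproj_direction//.
    by apply/rowP => i; rewrite !mxE; ring.
  apply: le_trans (eucl_normB _ _) _.
  have := eucl_normD (oproj (direction P) x - oproj (direction Q) x) (oproj (direction Q) (x - x')).
  have := proj x; have := oproj_norm_le (direction Q) (x - x').
  have : 2 * (c * e) * eucl_norm x <= 2 * (c * e) * b by rewrite ler_wpM2l// mulr_ge0.
  by move: xx'; lra.
rewrite /plane_dist; apply: le_trans (lerD dirle offle) _.
by rewrite le_eqVlt; apply/orP; left; apply/eqP; ring.
Qed.

Lemma plane_distxx {R : realType} (n k : nat) (P : affine_plane R n k) : plane_dist P P = 0.
Proof.
rewrite /plane_dist subrr eucl_norm0 addr0.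
have [[z z1]|z0] := pselect ([set z : 'rV[R]_n | eucl_norm z = 1] !=set0).
  rewrite (_ : image _ _ = [set 0]) ?sup1//; apply/seteqP; split=> [_ [y _ <-]|_ ->].
    by rewrite subrr eucl_norm0.
  by exists z; rewrite // subrr eucl_norm0.
have -> : [set z : 'rV[R]_n | eucl_norm z = 1] = set0 by apply: contrapT => /eqP/set0P.
by rewrite image_set0 sup0.
Qed.

Section planes_through_points.
Context {R : realType} {m l h : nat}.
Notation n := (m + l + h)%N.
Notation plane := (affine_plane R n (m + l)).
Implicit Types (p : option 'I_m -> 'rV[R]_n) (D : 'M[R]_(l, h)).
Notation index := ({ffun option 'I_m -> nat} * {ffun 'I_h -> 'I_n} * {ffun 'I_l -> 'I_n} * nat)%type.

(** The point indexed by [None] is the base point. Once [f] and [g] are fixed, the continuous data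
    are the [m + 1] points and the [l * h] entries of [D]; with [k = m + l] and [n = k + h], this
    number of entries is [(k - m) * (n - k)]. *)
Definition frame p D (f : {ffun 'I_h -> 'I_n}) (g : {ffun 'I_l -> 'I_n}) : 'M[R]_(m + l, n) :=
  col_mx (\matrix_i (p (Some i) - p None)) (rowsub g 1%:M + D *m rowsub f 1%:M).

(** The index gathers all that is discrete: the piece of the cover holding each point, the choices
    [f] and [g], and a common bound [q] on the right inverse, on [D] and on the base point. Indices
    form a countable type, so they cut a set of planes into countably many pieces. *)
Definition framed (A : (set 'rV[R]_n)^nat) (P : plane) p D (i : index) : Prop :=
  let: (a, f, g, q) := i in
  [/\ forall o, plane_set P (p o) /\ A (a o) (p o),
      (frame p D f g <= direction P)%MS,
      exists T, frame p D f g *m T = 1%:M /\ forall i j, `|T i j| <= q%:R,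
      forall i j, `|D i j| <= q%:R &
      eucl_norm (p None) <= q%:R].

Lemma exists_framed (A : (set 'rV[R]_n)^nat) F (P : plane) (x0 : 'rV[R]_n)
    (M : 'M[R]_(m, n)) : F `<=` \bigcup_i A i -> row_free M ->
  (F `&` plane_set P) x0 -> (forall i, (F `&` plane_set P) (row i M + x0)) ->
  exists pD, exists i, framed A P pD.1 pD.2 i.
Proof.
move=> FA freeM Fx0 FM.
pose p o := if o is Some i then row i M + x0 else x0.
have Fp o : (F `&` plane_set P) (p o) by case: o => [i|]; [exact: FM|exact: Fx0].
have /choice[a aP] : forall o, exists j, A j (p o).
  by move=> o; have [/FA[j _ Aj] _] := Fp o; exists j.
have ME : \matrix_i (p (Some i) - p None) = M.
  by apply/row_matrixP => i; rewrite rowK /p addrK.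
have MP : (M <= direction P)%MS.
  apply/row_subP => i; have [_ P1] := FM i; have [_ P0] := Fx0.
  rewrite /plane_set /= in P1 P0.
  have -> : row i M = (row i M + x0 - offset P) - (x0 - offset P).
    by rewrite opprB addrA subrK addrK.
  by rewrite addmx_sub ?eqmx_opp.
have [f [g [D [NP freeN]]]] := adapted_basis (rank_direction P) freeM MP.
have /row_freeP[T NT] := freeN.
have [q1 Tq] := mx_bounded T; have [q2 Dq] := mx_bounded D.
pose q3 := Num.bound (eucl_norm x0).
have q3P : eucl_norm x0 <= q3%:R by apply/ltW/archi_boundP; exact: eucl_norm_ge0.
exists (p, D), ([ffun o => a o], f, g, (q1 + q2 + q3)%N); split=> /=.
- by move=> o; rewrite ffunE; split; [have [] := Fp o|exact: aP].
- by rewrite /frame ME.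
- exists T; rewrite /frame ME; split=> // i j; apply: le_trans (Tq i j) _.
  by rewrite ler_nat; lia.
- by move=> i j; apply: le_trans (Dq i j) _; rewrite ler_nat; lia.
- by apply: le_trans q3P _; rewrite ler_nat; lia.
Qed.

(** A row of differences involves two points and moves by at most [2 * e]; the other rows move by
    [D - D'] times a matrix with entries 0 and 1, hence by at most [h * e]. *)
Lemma frame_diff_le p p' D D' f g (e : R) : 0 <= e ->
  (forall o, eucl_dist (p o) (p' o) <= e) -> (forall i j, `|D i j - D' i j| <= e) ->
  forall i j, `|(frame p D f g - frame p' D' f g) i j| <= (h%:R + 2) * e.
Proof.
move=> e0 pp' DD' i j; rewrite /frame opp_col_mx add_col_mx.
have pe o k : `|p o 0 k - p' o 0 k| <= e.
  by have := coord_le_eucl_norm (p o - p' o) k; rewrite !mxE => /le_trans; apply; exact: pp'.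
have he0 : 0 <= h%:R * e by rewrite mulr_ge0.
rewrite -[i]splitK; case: (fintype.split i) => k /=.
  rewrite col_mxEu !mxE.
  have /ler_normlP[a1 a2] := pe (Some k) j; have /ler_normlP[b1 b2] := pe None j.
  by rewrite ler_norml; apply/andP; split; lra.
rewrite col_mxEd opprD addrACA subrr add0r -mulmxBl.
apply: (@le_trans _ _ (h%:R * (e * 1))); last by lra.
apply: mulmx_entry_le => // [a b|a b]; first by rewrite !mxE.
by rewrite !mxE; case: (_ == _); rewrite ?normr1 ?normr0.
Qed.

(** Fix a frame for each plane. On the piece of one index, the plane is a Lipschitz function of
    [m + 1] points, each in a piece of exponent [v], and of [l * h] bounded numbers, each of
    exponent 1. *)
Lemma packing_dim_planes_le (calP : set plane) (F : set 'rV[R]_n) (v : R) : 0 <= v ->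
  sigma_box_le eucl_dist F v ->
  (forall P, calP P -> exists x0 (M : 'M[R]_(m, n)), [/\ row_free M,
     (F `&` plane_set P) x0 & forall i, (F `&` plane_set P) (row i M + x0)]) ->
  plane -> (packing_dim plane_dist calP <= (m.+1%:R * v + (l * h)%:R)%:E)%E.
Proof.
move=> v0 [A [FA Av]] calPF P0.
have /choice[pD pDP] : forall P, exists pD, calP P -> exists i, framed A P pD.1 pD.2 i.
  move=> P; have [Pc|] := pselect (calP P); last by exists (fun=> 0, 0).
  have [x0 [M [freeM Fx0 FM]]] := calPF P Pc.
  by have [pD pDi] := exists_framed FA freeM Fx0 FM; exists pD.
have s0 : 0 <= m.+1%:R * v + (l * h)%:R by rewrite addr_ge0 ?mulr_ge0.
apply: (packing_dim_le P0) => //; first exact: plane_distxx.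
pose Q (i : index) := [set P | calP P /\ framed A P (pD P).1 (pD P).2 i].
apply: (@countable_sigma_box_le _ _ _ _ Q) => // [P Pc|[[[a f] g] q]].
  by have [i iP] := pDP P Pc; exists i.
pose S (i : option 'I_m + 'I_l * 'I_h) : Type := if i is inl _ then 'rV[R]_n else R.
pose dS (i : option 'I_m + 'I_l * 'I_h) : S i -> S i -> R :=
  match i with inl _ => eucl_dist | inr _ => fun x y : R => `|x - y| end.
pose B (i : option 'I_m + 'I_l * 'I_h) : set (S i) :=
  match i with inl o => A (a o) | inr _ => [set x : R | `|x| <= q%:R] end.
pose u (i : option 'I_m + 'I_l * 'I_h) : R := if i is inl _ then v else 1.
pose y (P : plane) (i : option 'I_m + 'I_l * 'I_h) : S i :=
  match i with inl o => (pD P).1 o | inr ij => (pD P).2 ij.1 ij.2 end.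
have -> : m.+1%:R * v + (l * h)%:R = \sum_i u i.
  rewrite big_sumType /= !sumr_const card_option card_prod !card_ord.
  by rewrite -[X in _ = X + _]mulr_natl.
pose c : R := n%:R * ((m + l)%:R * (n%:R * q%:R)).
have c0 : 0 <= c by rewrite !mulr_ge0.
have h2 : 1 <= h%:R + 2 :> R by have : 0 <= h%:R :> R by []; lra.
(* The constant of [plane_dist_le] at [b = q], times the factor from [frame_diff_le]. *)
pose L := 2 * (c * (1 + q%:R) + 1) * (h%:R + 2).
apply: (@upper_box_le_product _ _ _ _ S dS B u _ y L).
- by rewrite /L !mulr_gt0// ?ltr_wpDl// mulr_ge0// addr_ge0.
- by case=> [k|ij]; [exact: Av|exact: upper_box_le_interval].
- move=> P [_ [pA _ _ Dq _]]; case=> [k|ij]; last exact: Dq.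
  by have [] := pA k.
move=> P P' e [_ [pA NP [T [NT Tq]] Dq p0]] [_ [pA' NP' [T' [NT' Tq']] Dq' p0']] e0 PP'.
rewrite /L -mulrA.
have pp' o : eucl_dist ((pD P).1 o) ((pD P').1 o) <= e by exact: (PP' (inl o)).
have DD' i j : `|(pD P).2 i j - (pD P').2 i j| <= e by exact: (PP' (inr (i, j))).
apply: (plane_dist_le _ _ (pA None).1 (pA' None).1 NP NP' NT NT' Tq Tq') => //.
- by rewrite mulr_ge0 ?(ltW e0)//; lra.
- exact: frame_diff_le (ltW e0) pp' DD'.
- by apply: le_trans (pp' None) _; rewrite ler_peMl// ltW.
Qed.

End planes_through_points.

(** * The lower bound for the union *)

Lemma affine_plane_inhabited {R : realType} (n k : nat) : (k <= n)%N -> affine_plane R n k.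
Proof.
move=> kn; have rk : \rank (pid_mx k : 'M[R]_n) = k by rewrite rank_pid_mx.
by have [P _] := cid (plane_set_surj 0 rk).
Qed.

Theorem theorem2 (R : realType) (n k : nat) (hk : (1 <= k <= n)%N)
    (calP : set (affine_plane R n k)) (t s : R) (ht : 0 < t) (hs : 0 < s)
    (hcalP : packing_dim plane_dist calP = t%:E)
    (P' : affine_plane R n k -> set 'rV[R]_n)
    (hP' : forall P, calP P ->
       P' P `<=` plane_set P /\ (s%:E <= packing_dim eucl_dist (P' P))%E) :
  ((Num.max s
      ((t - (k%:R - (Num.ceil s)%:~R) * (n%:R - k%:R)) /
       ((Num.ceil s)%:~R + 1)))%:E
   <= packing_dim eucl_dist (\bigcup_(P in calP) P' P))%E.
Proof.
have [k0 kn] := andP hk.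
have P0 : affine_plane R n k by exact: affine_plane_inhabited.
set F := \bigcup_(P in calP) P' P.
have [P1 calP1] : exists P, calP P.
  apply: contrapT => calP0; suff : (t%:E <= 0%:E)%E by rewrite lee_fin leNgt ht.
  rewrite -hcalP; apply: (packing_dim_le P0) => //; first exact: plane_distxx.
  exists (fun=> set0); split=> [P cP|_]; last exact: upper_box_le_set0.
  by case: calP0; exists P.
pose m := `|Num.ceil s|%N.
have mE : (Num.ceil s)%:~R = m%:R :> R.
  by rewrite natr_absz ger0_norm// ltW// ceil_gt0.
(* An integer below the ceiling of [s] is below [s] itself, as [independent_points] requires for [m]
   independent differences. *)
have ms d : (d < m)%N -> (d%:R < s).
  by move=> dm; rewrite pmulrn -ceil_gt_int -(@ltr_int R) mE ltr_nat.
have points P : calP P -> exists x0 (M : 'M[R]_(m, n)), [/\ row_free M,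
     (F `&` plane_set P) x0 & forall i, (F `&` plane_set P) (row i M + x0)].
  move=> cP; have [P'P sP'] := hP' P cP.
  have FP x : P' P x -> (F `&` plane_set P) x.
    by move=> P'x; split; [exists P|exact: P'P].
  have [x0 P'x0] : exists x, P' P x.
    apply: contrapT => P'0; suff : (s%:E <= 0%:E)%E by rewrite lee_fin leNgt hs.
    apply: le_trans sP' _; apply: (@packing_dim_affine_le _ n 0 0 0) => x P'x.
    by case: P'0; exists x.
  have [|M [freeM MP']] := @independent_points _ _ m (P' P) x0.
    by move=> d /ms ds; apply: lt_le_trans sP'; rewrite lte_fin.
  by exists x0, M; split=> // [|i]; exact: FP.
(* The [m] independent differences lie in a [k]-dimensional direction; so [k - m] is a natural
   number. *)
have mk : (m <= k)%N.
  have [x0 [M [/eqP freeM [_ Px0] MP]]] := points P1 calP1.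
  rewrite -freeM -(rank_direction P1); apply/mxrankS/row_subP => i.
  have [_ PMi] := MP i; rewrite /plane_set /= in Px0 PMi.
  have -> : row i M = (row i M + x0 - offset P1) - (x0 - offset P1).
    by rewrite opprB addrA subrK addrK.
  by rewrite addmx_sub ?eqmx_opp.
(* Were the dimension of [F] below one of the two terms, [F] would have a countable cover of some
   box exponent [v] below that term. For the term [s], the subset [P' P1] of [F] already contradicts
   this. *)
rewrite EFin_max ge_max; apply/andP; split; rewrite leNgt; apply/negP;
  move=> /(packing_dim_lt 0 (@eucl_distC R n) (@eucl_dist_triangle R n))[v [v0 + Fv]].
  have [_ sP1] := hP' P1 calP1.
  have : (packing_dim eucl_dist (P' P1) <= v%:E)%E.
    apply: (packing_dim_le 0 (@eucl_distxx R n)) => //.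
    by apply: sub_sigma_box_le Fv; exact: bigcup_sup.
  by move=> /(le_trans sP1); rewrite lee_fin leNgt => /negP.
(* Rewriting [k] and [n] as sums gives the matrix sizes the shape that [packing_dim_planes_le]
   expects; its bound on [t] then contradicts the choice of [v]. *)
have [l kE] : exists l, k = (m + l)%N by exists (k - m)%N; lia.
have [h nE] : exists h, n = (k + h)%N by exists (n - k)%N; lia.
rewrite mE; clear hk k0 kn mk; subst k; subst n => vlt.
have := packing_dim_planes_le v0 Fv points P0.
rewrite hcalP lee_fin => tle.
have m1 : 0 < m%:R + 1 :> R by rewrite ltr_wpDl.
move: vlt; rewrite ltr_pdivlMr//.
move: tle; rewrite !natrD natrM -natr1 => tle vlt.
suff : t < t by rewrite ltxx.
by apply: le_lt_trans tle _; lra.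
Qed.
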